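(* Let $k \ge 2$ be an integer and let $G$ be a graph of maximum degree $\Delta(G)=\Delta$ and order $n(G)$. (a) If $n(G) \ge k^{\Delta-k+1}(\Delta^2+1)$, then $\mathrm{a}_k'(G) \ge k$ and $\mathrm{b}_{k-1}'(G) \le k$. (b) If $\Delta \ge k$ and $n(G) \ge (k^{\Delta-k+1}+1)(\Delta^2+1)$, then $\mathrm{a}_k(G) \ge k$ and $\mathrm{b}_{k-1}(G) \le k$. (c) If $\Delta < k$ and $n(G) > (k-1)(\Delta+1)$, then $\mathrm{a}_k(G) \ge k$ and $\mathrm{b}_{k-1}(G) \le k$.
   Context: Graphs are finite, simple and undirected. For positive integers $a,b$, the $(a,b)$-biased Maker-Breaker domination game on a graph $G$ is played by Dominator and Staller, who move alternately; on each move Dominator selects $a$ unplayed vertices and Staller selects $b$ unplayed vertices (if fewer unplayed vertices remain than the player's bias, the player selects all remaining ones). Dominator wins if the vertices he selected during the game form a dominating set of $G$; otherwise Staller wins, equivalently, Staller wins iff she claims all vertices of the closed neighborhood $N[v]$ of some vertex $v$. In the D-game Dominator moves first; in the S-game Staller moves first. Let $W(G,a,b)\in\{D,S\}$ (resp. $W'(G,a,b)\in\{D,S\}$) denote the winner of the $(a,b)$-biased D-game (resp. S-game) under optimal play, with $D$ standing for Dominator and $S$ for Staller. For a positive integer $\ell$ the thresholds, with minima over positive integers and value $\infty$ if the minimum does not exist, are $\mathrm{a}_\ell(G)=\min\{a: W(G,a,\ell)=D\}$, $\mathrm{a}'_\ell(G)=\min\{a: W'(G,a,\ell)=D\}$,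 $\mathrm{b}_\ell(G)=\min\{b: W(G,\ell,b)=S\}$, $\mathrm{b}'_\ell(G)=\min\{b: W'(G,\ell,b)=S\}$. The exponent $\Delta-k+1$ may be negative in (a), in which case the power is read as a rational number. *)

(* Defs.v *)
(* MathComp, with classical choice (mathcomp-classical) for minima of sets of
   naturals that may be empty. *)
From HB Require Import structures.
From mathcomp Require Import all_boot all_order all_algebra.
From mathcomp Require Import boolp.

Set Implicit Arguments.
Unset Strict Implicit.
Unset Printing Implicit Defensive.

Record sgraph := SGraph {
  vertex :> finType;
  edge : rel vertex;
  edge_sym : symmetric edge;
  edge_irrefl : irreflexive edge }.

Definition order_of (G : sgraph) : nat := #|G|.

Definition degree (G : sgraph) (v : G) : nat := #|[set u : G | edge v u]|.

Definition max_degree (G : sgraph) : nat := \max_(v : G) degree v.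

Definition dominating (G : sgraph) (D : {set G}) : bool :=
  [forall v : G, (v \in D) || [exists u in D, edge v u]].

Inductive player := Dominator | Staller.

Definition is_dominator (p : player) : bool :=
  if p is Dominator then true else false.

Definition player_of_bool (b : bool) : player :=
  if b then Dominator else Staller.

Lemma is_dominatorK : cancel is_dominator player_of_bool.
Proof. by case. Qed.

HB.instance Definition _ := Equality.copy player (can_type is_dominatorK).

Definition other (p : player) : player :=
  if p is Dominator then Staller else Dominator.

Section Game.
Variables (G : sgraph) (a b : nat).

(* The vertices selected so far by Dominator and by Staller, respectively. *)
Definition position : Type := ({set G} * {set G})%type.

Definition unplayed (x : position) : {set G} := ~: (x.1 :|: x.2).

Definition bias (p : player) : nat := if p is Dominator then a else b.

Definition legal (p : player) (x : position) (M : {set G}) : bool :=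
  (M \subset unplayed x) && (#|M| == minn (bias p) #|unplayed x|).

Definition select (p : player) (x : position) (M : {set G}) : position :=
  if p is Dominator then (x.1 :|: M, x.2) else (x.1, x.2 :|: M).

Definition final_winner (x : position) : player :=
  if dominating x.1 then Dominator else Staller.

(* Backward induction, with p to move; m bounds the number of remaining moves.
   Since every move of a game with positive biases plays at least one vertex,
   the bound #|unplayed x| used in [winner] is never a restriction: see
   [winnerE]. *)
Fixpoint winner_rec (m : nat) (p : player) (x : position) : player :=
  if unplayed x == set0 then final_winner x
  else if m is m'.+1 then
    if [exists M : {set G},
          legal p x M && (winner_rec m' (other p) (select p x M) == p)]
    then p else other p
  else final_winner x.

Definition winner (p : player) (x : position) : player :=
  winner_rec #|unplayed x| p x.

Lemma unplayed_select p x M : unplayed (select p x M) = unplayed x :\: M.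
Proof.
by apply/setP=> v; case: p; rewrite /unplayed !inE /=;
  case: (v \in x.1); case: (v \in x.2); case: (v \in M).
Qed.

Lemma card_unplayed_select p x M : 0 < a -> 0 < b ->
  unplayed x != set0 -> legal p x M ->
  #|unplayed (select p x M)| < #|unplayed x|.
Proof.
move=> a0 b0; rewrite -card_gt0 => x0 /andP[sM /eqP cM].
rewrite unplayed_select cardsD (setIidPr sM) cM.
have c0 : 0 < bias p by case: p {cM}.
have h : 0 < minn (bias p) #|unplayed x| by rewrite leq_min c0.
by rewrite -subn_gt0 subKn // geq_minr.
Qed.

Lemma winner_rec_bound m p x : 0 < a -> 0 < b ->
  #|unplayed x| <= m -> winner_rec m p x = winner p x.
Proof.
move=> a0 b0; rewrite /winner.
have [n] := ubnP m; elim: n m p x => // n IH [|m] p x lt_mn le_xm.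
  by move: le_xm; rewrite leqn0 => /eqP->.
case Ex: (#|unplayed x|) => [|u] /=.
  by move/eqP: Ex; rewrite cards_eq0 => ->.
case: ifP => // /negbT x0.
congr (if _ then _ else _); apply: eq_existsb => M.
case lM: (legal p x M) => //=.
have := card_unplayed_select a0 b0 x0 lM; rewrite Ex ltnS => le_u.
have le_um : u <= m by rewrite -ltnS -Ex.
rewrite (IH m) //; last exact: leq_trans le_um.
by rewrite -(IH u) //; exact: leq_ltn_trans le_um _.
Qed.

Lemma winnerE p x : 0 < a -> 0 < b ->
  winner p x =
    if unplayed x == set0 then final_winner x
    else if [exists M : {set G},
               legal p x M && (winner (other p) (select p x M) == p)]
         then p else other p.
Proof.
move=> a0 b0; rewrite {1}/winner.
case Ex: (#|unplayed x|) => [|u] /=.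
  by move/eqP: Ex; rewrite cards_eq0 => ->.
case: ifP => // /negbT x0.
congr (if _ then _ else _); apply: eq_existsb => M.
case lM: (legal p x M) => //=.
by rewrite winner_rec_bound // -ltnS -Ex card_unplayed_select.
Qed.

End Game.

(* [W G a b] is the winner of the (a,b)-biased D-game, [W' G a b] that of the
   S-game. *)
Definition W (G : sgraph) (a b : nat) : player :=
  winner a b Dominator ((set0, set0) : position G).

Definition W' (G : sgraph) (a b : nat) : player :=
  winner a b Staller ((set0, set0) : position G).

(* Extended naturals: None is infinity. *)
Definition enat : Type := option nat.

Definition enat_le (x y : enat) : bool :=
  match x, y with
  | _, None => true
  | None, Some _ => false
  | Some m, Some n => m <= n
  end.

Definition min_positive (P : pred nat) : enat :=
  match pselect (exists n, (0 < n) && P n) with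
  | left exP => Some (ex_minn exP)
  | right _ => None
  end.

(* The trailing quote marks the S-game. *)
Definition thr_a (G : sgraph) (l : nat) : enat :=
  min_positive (fun a => W G a l == Dominator).

Definition thr_a' (G : sgraph) (l : nat) : enat :=
  min_positive (fun a => W' G a l == Dominator).

Definition thr_b (G : sgraph) (l : nat) : enat :=
  min_positive (fun b => W G l b == Staller).

Definition thr_b' (G : sgraph) (l : nat) : enat :=
  min_positive (fun b => W' G l b == Staller).

(* Main.v *)
(* Staller plays a box game on pairwise disjoint closed neighborhoods that
   Dominator has not met.  A greedy choice gives one such box for every
   Delta^2+1 candidate centers.  Staller treats boxes in groups of k, one vertex
   in each; Dominator answers by spoiling at most k-1 boxes.  If T boxes have
   been treated and U have not, then k*T + U does not decrease, so k^(e+1) boxes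
   with at most k+e+1 free vertices become k^e boxes with at most k+e free
   vertices, and finally one box that Staller can fill in a single move.  In the
   D-game the centers are chosen among the vertices left undominated by the first
   move, which dominates at most (k-1)(Delta+1) vertices. *)
Require Import Defs.
From mathcomp Require Import all_boot all_order all_algebra.
From mathcomp Require Import boolp zify.

Import Order.TTheory GRing.Theory Num.Theory.

Set Implicit Arguments.
Unset Strict Implicit.

(** * Finite sets of prescribed size, and disjointness *)

Lemma exists_subset_card (T : finType) (A : {set T}) n :
  n <= #|A| -> exists2 B : {set T}, B \subset A & #|B| = n.
Proof.
elim: n => [|n IH] hn; first by exists set0; rewrite ?sub0set ?cards0.
have [B sB cB] := IH (ltnW hn).
have : 0 < #|A :\: B| by rewrite cardsD (setIidPr sB) cB subn_gt0.
case/card_gt0P=> v /setDP[vA vB]; exists (v |: B).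
  by rewrite subUset sub1set vA.
by rewrite cardsU1 vB cB.
Qed.

Lemma exists_superset_card (T : finType) (A B : {set T}) n :
  B \subset A -> #|B| <= n <= #|A| ->
  exists M : {set T}, [/\ B \subset M, M \subset A & #|M| = n].
Proof.
move=> sB /andP[Bn nA].
have : n - #|B| <= #|A :\: B| by rewrite cardsD (setIidPr sB) leq_sub2r.
case/exists_subset_card=> C sC cC; exists (B :|: C).
have [sCA dCB] : C \subset A /\ [disjoint C & B].
  by apply/andP; rewrite -subsetD.
split; first exact: subsetUl.
  by rewrite subUset sB.
have /eqP : #|B :|: C| == #|B| + #|C|.
  by rewrite (leq_card_setU B C).2 disjoint_sym.
by rewrite cC subnKC.
Qed.

Lemma disjoint_setUl (T : finType) (A B C : {set T}) :
  [disjoint A :|: B & C] = [disjoint A & C] && [disjoint B & C].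
Proof. by rewrite -!setI_eq0 setIUl setU_eq0. Qed.

Lemma disjoint_setUr (T : finType) (A B C : {set T}) :
  [disjoint A & B :|: C] = [disjoint A & B] && [disjoint A & C].
Proof. by rewrite -!setI_eq0 setIUr setU_eq0. Qed.

(** * Closed neighborhoods and packings of them *)

Section ClosedNeighborhoods.
Context {G : sgraph}.
Implicit Types (u v w : G) (P A N X T U K M : {set G}) (x : position G).

Definition closed_nbhd v : {set G} := v |: [set u | edge v u].

Lemma closed_nbhd_sym u v : (u \in closed_nbhd v) = (v \in closed_nbhd u).
Proof. by rewrite !inE eq_sym (edge_sym u v). Qed.

Lemma card_nbhd v : #|[set u : G | edge v u]| <= max_degree G.
Proof. exact: (@leq_bigmax _ (fun v : G => degree v) v). Qed.

Lemma card_closed_nbhd v : #|closed_nbhd v| <= (max_degree G).+1.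
Proof. by rewrite cardsU1; apply: leq_add (leq_b1 _) (card_nbhd v). Qed.

(** Such a [u] is within distance 2 of [v]. Apart from [v] itself, it lies in the closed
    neighborhood of one of the at most Delta neighbors of [v], and each of these contributes at most
    Delta vertices other than [v]. *)
Lemma card_nbhd_conflict v :
  #|[set u | ~~ [disjoint closed_nbhd u & closed_nbhd v]]|
    <= max_degree G ^ 2 + 1.
Proof.
set D := max_degree G.
pose F (w : G) : {set G} := closed_nbhd w :\ v.
pose nv := [set u | edge v u].
have sub : [set u | ~~ [disjoint closed_nbhd u & closed_nbhd v]]
    \subset v |: \bigcup_(w in nv) F w.
  apply/subsetP=> u; rewrite inE => /pred0Pn[w /andP[/= wu wv]].
  have [->|uv] := eqVneq u v; first by rewrite setU11.
  apply/setU1P; right; apply/bigcupP.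
  move: wv; rewrite !inE => /predU1P[ewv|vw]; last first.
    by exists w; rewrite ?inE // uv /=; move: wu; rewrite closed_nbhd_sym !inE.
  (* If the common vertex is [v], then [u] is adjacent to [v] and serves as its own neighbor [w]. *)
  exists u; last by rewrite !inE uv eqxx.
  by move: wu; rewrite !inE ewv eq_sym (negPf uv) /= edge_sym.
have cF w : w \in nv -> #|F w| <= D.
  rewrite inE => vw; have := card_closed_nbhd w.
  by rewrite (cardsD1 v) closed_nbhd_sym !inE vw orbT.
apply: leq_trans (subset_leq_card sub) _.
rewrite cardsU1 addnC leq_add ?leq_b1 //.
have : #|\bigcup_(w in nv) F w| <= \sum_(w in nv) #|F w|.
  apply: (big_ind2 (fun (A : {set G}) n => #|A| <= n)) => //.
    by rewrite cards0.
  by move=> A m B n hA hB; apply: leq_trans (leq_card_setU A B).1 (leq_add hA hB).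
move/leq_trans; apply; apply: leq_trans (leq_sum _ cF) _.
by rewrite sum_nat_const leq_mul2r card_nbhd orbT.
Qed.

Definition packing P :=
  {in P &, forall u v, u != v -> [disjoint closed_nbhd u & closed_nbhd v]}.

(** Greedy: choosing [v] discards only the candidates in conflict with it, at most Delta^2+1
    including [v]. *)
Lemma exists_packing m A : m * (max_degree G ^ 2 + 1) <= #|A| ->
  exists P, [/\ P \subset A, m <= #|P| & packing P].
Proof.
elim: m A => [|m IH] A; first by exists set0; split=> // [|u]; rewrite ?sub0set ?inE.
set D := max_degree G ^ 2 + 1 => hA.
have /card_gt0P[v vA] : 0 < #|A| by apply: leq_trans hA; rewrite /D; lia.
set C := [set u | ~~ [disjoint closed_nbhd u & closed_nbhd v]].
have cC : #|C| <= D := card_nbhd_conflict v.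
have [|P [sP cP pP]] := IH (A :\: C).
  rewrite cardsD leq_subRL; last exact: subset_leq_card (subsetIl _ _).
  apply: leq_trans hA; rewrite mulSn leq_add2r.
  by apply: leq_trans cC; apply: subset_leq_card (subsetIr _ _).
have dP u : u \in P -> [disjoint closed_nbhd u & closed_nbhd v].
  by move/(subsetP sP); rewrite !inE negbK => /andP[].
have vC : v \in C by rewrite inE; apply/pred0Pn; exists v; rewrite /= setU11.
have vP : v \notin P by apply/negP=> /(subsetP sP); rewrite inE vC.
exists (v |: P); split.
- rewrite subUset sub1set vA; apply: subset_trans sP (subsetDl _ _).
- by rewrite cardsU1 vP.
- move=> u w /setU1P[->|uP] /setU1P[->|wP]; rewrite ?eqxx // => uw.
  + by rewrite disjoint_sym dP.
  + by rewrite dP.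
  + exact: pP.
Qed.

Lemma packing_sub P X : X \subset P -> packing P -> packing X.
Proof. by move=> /subsetP s pP u v /s uP /s vP; apply: pP. Qed.

(** Picking a point of [N] in each closed neighborhood is injective by disjointness. Hence a move
    spoils at most as many boxes as it has vertices. *)
Lemma card_packing_hit P N :
  packing P -> {in P, forall v, ~~ [disjoint closed_nbhd v & N]} -> #|P| <= #|N|.
Proof.
move=> pP hP; pose g v := odflt v [pick u in closed_nbhd v :&: N].
have gP v : v \in P -> g v \in closed_nbhd v :&: N.
  move/hP/pred0Pn=> [u /= uN]; rewrite /g; case: pickP => [//|/(_ u)].
  by rewrite inE uN.
rewrite -(card_in_imset (f := g) (D := P)).
  by apply/subset_leq_card/subsetP=> _ /imsetP[v /gP/setIP[_ ?] ->].
move=> u v uP vP e; apply/eqP; apply: contraT => uv.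
have /setIP[gu _] := gP _ uP; have /setIP[gv _] := gP _ vP.
by move: (disjointFr (pP _ _ uP vP uv) gu); rewrite e gv.
Qed.

(** * Boxes in a position *)

Definition undominated x v := [disjoint closed_nbhd v & x.1].

(** Subtracting Staller's vertices is enough: around an undominated vertex Dominator has none. *)
Definition free_part x v : {set G} := closed_nbhd v :\: x.2.

Lemma free_part_unplayed x v :
  undominated x v -> free_part x v \subset unplayed x.
Proof.
move=> lv; apply/subsetP=> u /setDP[uv u2].
by rewrite !inE negb_or u2 (disjointFr lv).
Qed.

Lemma final_winner_undominated x v :
  undominated x v -> final_winner x = Staller.
Proof.
move=> lv; rewrite /final_winner /dominating ifF //.
apply/forallP=> /(_ v) /orP[vx|/existsP[u /andP[ux vu]]].
  by move: (disjointFl lv vx); rewrite setU11.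
by move: (disjointFl lv ux); rewrite !inE vu orbT.
Qed.

Lemma card_closed_nbhd_hit N :
  #|[set v : G | ~~ [disjoint closed_nbhd v & N]]| <= #|N| * (max_degree G).+1.
Proof.
have -> : [set v : G | ~~ [disjoint closed_nbhd v & N]]
    = \bigcup_(w in N) closed_nbhd w.
  apply/setP=> v; rewrite inE; apply/pred0Pn/bigcupP => [[w /= /andP[wv wN]]|[w wN vw]].
    by exists w; rewrite // closed_nbhd_sym.
  by exists w; rewrite /= closed_nbhd_sym vw.
rewrite -sum_nat_const.
apply: (big_ind2 (fun (A : {set G}) n => #|A| <= n)); first by rewrite cards0.
  by move=> A m B n hA hB; apply: leq_trans (leq_card_setU A B).1 (leq_add hA hB).
by move=> w _; apply: card_closed_nbhd.
Qed.

(** * Single moves and completed boxes *)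

Section Strategy.
Variables a b : nat.

Lemma exists_legal_superset p x M :
  M \subset unplayed x -> #|M| <= bias a b p ->
  exists2 M' : {set G}, M \subset M' & legal a b p x M'.
Proof.
move=> sM cM; have [|M' [s1 s2 c]] :=
    @exists_superset_card _ _ _ (minn (bias a b p) #|unplayed x|) sM.
  by rewrite leq_min cM subset_leq_card // geq_minr.
by exists M'; rewrite // /legal s2 c eqxx.
Qed.

(** Both conditions survive every move, since Dominator can select only unplayed vertices and none
    is left around [v]. Letting [m] be arbitrary makes the induction on the recursion bound
    direct. *)
Lemma winner_rec_claimed v m p x : undominated x v -> free_part x v = set0 ->
  winner_rec a b m p x = Staller.
Proof.
elim: m p x => [|m IH] p x lv fv /=; rewrite (final_winner_undominated lv) ?if_same //.
case: ifP => // _.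
have step M : M \subset unplayed x -> winner_rec a b m (other p) (select p x M) = Staller.
  move=> sM; case: p => /=; apply: IH; rewrite /undominated /free_part /=.
  - rewrite disjoint_setUr; apply/andP; split=> //.
    apply: disjointWr sM _; rewrite -setI_eq0 -subset0 -fv.
    by apply/subsetP=> u; rewrite !inE negb_or => /and3P[-> _ ->].
  - exact: fv.
  - exact: lv.
  - by rewrite setDUr -/(free_part x v) fv set0I.
case: p step => step.
  rewrite ifF //; apply/existsP=> -[M /andP[/andP[sM _]]].
  by rewrite step.
rewrite ifT //; apply/existsP.
have [|M _ lM] := @exists_legal_superset Staller x set0 (sub0set _).
  by rewrite cards0.
by exists M; rewrite lM step //; case/andP: lM.
Qed.

Hypotheses (a_gt0 : 0 < a) (b_gt0 : 0 < b).

Lemma winner_unplayed0 p q x :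
  unplayed x = set0 -> winner a b p x = winner a b q x.
Proof. by move=> u0; rewrite !winnerE // u0 eqxx. Qed.

(** The inequality [#|M| <= a] also covers the short last move and, with [M] empty, a full board. *)
Lemma winner_Dominator_move x :
  (forall M, M \subset unplayed x -> #|M| <= a ->
     winner a b Staller (x.1 :|: M, x.2) = Staller) ->
  winner a b Dominator x = Staller.
Proof.
move=> h; have [u0|u0] := eqVneq (unplayed x) set0.
  rewrite (@winner_unplayed0 _ Staller) //.
  by have := h set0 (sub0set _); rewrite cards0 setU0; case: (x) => ? ?; apply.
rewrite winnerE // (negPf u0) ifF //.
apply/existsP=> -[M /andP[/andP[sM /eqP cM]]].
by rewrite /= h // cM geq_minl.
Qed.

(** Legality fixes the size of a move, so Staller names only the vertices [M0] that matter and must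
    cope with any completion of them. *)
Lemma winner_Staller_move x M0 :
  M0 \subset unplayed x -> #|M0| <= b ->
  (forall M, M0 \subset M -> winner a b Dominator (x.1, x.2 :|: M) = Staller) ->
  winner a b Staller x = Staller.
Proof.
move=> sM0 cM0 h; have [u0|u0] := eqVneq (unplayed x) set0.
  rewrite (@winner_unplayed0 _ Dominator) //.
  have /h : M0 \subset set0 by rewrite -u0.
  by rewrite setU0; case: (x).
rewrite winnerE // (negPf u0) ifT //.
have [M s1 lM] := @exists_legal_superset Staller x M0 sM0 cM0.
by apply/existsP; exists M; rewrite lM /= h.
Qed.

Lemma winner_one_box x v :
  undominated x v -> #|free_part x v| <= b -> winner a b Staller x = Staller.
Proof.
move=> lv cv; apply: (winner_Staller_move (free_part_unplayed lv) cv) => M sM.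
apply: (@winner_rec_claimed v) => //.
by apply/eqP; rewrite /free_part -setDDl /= setD_eq0.
Qed.

(** * The box game *)

Hypothesis a_lt_b : a < b.

(** [T] holds the treated boxes, [U] the untreated ones, and [n] bounds the number of rounds. The
    potential is [b * #|T| + #|U|]. *)
Lemma winner_boxes_step e :
  (forall x U, packing U ->
     {in U, forall v, undominated x v /\ #|free_part x v| <= b + e} ->
     b ^ e <= #|U| -> winner a b Staller x = Staller) ->
  forall n x T U, #|U| <= n -> [disjoint T & U] -> packing (T :|: U) ->
     {in T, forall v, undominated x v /\ #|free_part x v| <= b + e} ->
     {in U, forall v, undominated x v /\ #|free_part x v| <= b + e.+1} ->
     b ^ e.+1 <= b * #|T| + #|U| -> winner a b Staller x = Staller.
Proof.
move=> base; elim=> [|n IH] x T U cU dTU pTU hT hU hc.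
all: have [Ub|bU] := ltnP #|U| b.
(* With fewer than [b] untreated boxes, the potential gives b^(e+1) < b(|T|+1), so |T| >= b^e and
   [T] alone suffices. *)
1,3: apply: (base x T) => //; first exact: packing_sub (subsetUl _ _) pTU.
1,2: rewrite -ltnS -(ltn_pmul2l b_gt0) -expnS mulnS addnC.
1,2: by apply: leq_ltn_trans hc _; rewrite ltn_add2l.
  lia.
have [K sK cK] := exists_subset_card bU.
have dTK : [disjoint T & K] := disjointWr sK dTU.
(* The default [v] occurs only for a box with empty free part; intersecting with [unplayed x] keeps
   the move legal in that case. *)
pose f v := odflt v [pick u in free_part x v].
pose M0 := (f @: K) :&: unplayed x.
apply: (winner_Staller_move (subsetIr _ _ : M0 \subset _)).
  apply: leq_trans (subset_leq_card (subsetIl _ _)) _.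
  by apply: leq_trans (leq_imset_card _ _) _; rewrite cK.
move=> M sM; apply: winner_Dominator_move => N _ cN /=.
set y : position G := (x.1 :|: N, x.2 :|: M).
(* The boxes spoiled by Dominator's reply. *)
pose X := [set v in T :|: U | ~~ [disjoint closed_nbhd v & N]].
have cX : #|X| <= a.
  apply: leq_trans cN; apply: card_packing_hit => [|v].
    by apply: packing_sub pTU; apply/subsetP=> v; rewrite inE => /andP[].
  by rewrite inE => /andP[].
have ly v : v \in T :|: U -> v \notin X -> undominated x v -> undominated y v.
  rewrite [v \in X]inE => -> /=; rewrite negbK => dN lv.
  by rewrite /undominated disjoint_setUr; apply/andP.
have fy v : free_part y v \subset free_part x v by rewrite setDS // subsetUl.
have fK v : v \in K -> undominated x v -> #|free_part x v| <= b + e.+1 ->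
    #|free_part y v| <= b + e.
  move=> vK lv; rewrite addnS.
  case fv : [pick u in free_part x v] => [u|].
    move=> cv; rewrite -ltnS; apply: leq_trans cv; apply: proper_card.
    have uv : u \in free_part x v by case: pickP fv => // ? ? [<-].
    apply/properP; split=> //; exists u => //.
    have : u \in M0.
      rewrite inE (subsetP (free_part_unplayed lv)) // andbT.
      by apply/imsetP; exists v; rewrite // /f fv.
    by move/(subsetP sM); rewrite !inE => ->; rewrite orbT.
  case: pickP fv => // fv _ _; rewrite (leq_trans (subset_leq_card (fy v))) //.
  by rewrite (eq_card0 fv).
pose T' := (T :|: K) :\: X; pose U' := (U :\: K) :\: X.
have sT' : T' \subset T :|: U.
  by apply: subset_trans (subsetDl _ _) _; apply: setUS.
have sU' : U' \subset T :|: U.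
  apply: subset_trans (subsetDl _ _) _; apply: subset_trans (subsetDl _ _) _.
  exact: subsetUr.
have dis : [disjoint T :|: K & U :\: K].
  rewrite disjoint_setUl; apply/andP; split; first exact: disjointWr (subsetDl _ _) dTU.
  by rewrite disjoint_sym -setI_eq0 setIC setIDA setIC -setIDA setDv setI0.
have cTK : #|T :|: K| = #|T| + b.
  by rewrite -cK; apply/eqP; rewrite (leq_card_setU T K).2.
have cUK : #|U :\: K| = #|U| - b by rewrite cardsD (setIidPr sK) cK.
have cXX : #|(T :|: K) :&: X| + #|(U :\: K) :&: X| <= a.
  have d : [disjoint (T :|: K) :&: X & (U :\: K) :&: X].
    by apply: disjointWl (subsetIl _ _) _; apply: disjointWr (subsetIl _ _) _.
  have /eqP <- : #|((T :|: K) :&: X) :|: ((U :\: K) :&: X)|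
      == #|(T :|: K) :&: X| + #|(U :\: K) :&: X| by rewrite (leq_card_setU _ _).2.
  by apply: leq_trans cX; apply: subset_leq_card; rewrite -setIUl subsetIr.
have cTX := cardsID X (T :|: K); have cUX := cardsID X (U :\: K).
rewrite -/T' in cTX; rewrite -/U' in cUX.
apply: (IH y T' U').
- by have := leq_addl #|(U :\: K) :&: X| #|U'|; lia.
- by apply: disjointWl (subsetDl _ _) _; apply: disjointWr (subsetDl _ _) _.
- by apply: packing_sub pTU; rewrite subUset sT'.
- move=> v vT'; have vTU := subsetP sT' _ vT'.
  have /setDP[vTK vX] := vT'.
  case/setUP: vTK => [/hT[lv cv]|vK].
    by split; [exact: ly | apply: leq_trans (subset_leq_card (fy v)) cv].
  by have [lv cv] := hU _ (subsetP sK _ vK); split; [exact: ly | exact: fK].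
- move=> v vU'; have vTU := subsetP sU' _ vU'.
  have /setDP[/setDP[vU _] vX] := vU'; have [lv cv] := hU _ vU.
  by split; [exact: ly | apply: leq_trans (subset_leq_card (fy v)) cv].
(* Moving [b] boxes from [U] to [T] gains b^2 - b; losing at most a <= b-1 boxes costs at most b
   each, so at most b(b-1). *)
- by apply: leq_trans hc _; nia.
Qed.

Lemma winner_boxes e x U : packing U ->
  {in U, forall v, undominated x v /\ #|free_part x v| <= b + e} ->
  b ^ e <= #|U| -> winner a b Staller x = Staller.
Proof.
elim: e x U => [|e IH] x U pU hU cU.
  have /card_gt0P[v /hU[lv cv]] := cU.
  by apply: winner_one_box lv _; rewrite addn0 in cv.
apply: (winner_boxes_step IH (leqnn #|U|) (T := set0)) => //.
- by rewrite -setI_eq0 set0I.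
- by rewrite set0U.
- by move=> v; rewrite inE.
- by rewrite cards0 muln0.
Qed.

(** A closed neighborhood has at most Delta+1 <= b+e vertices, so every box of a packing in [A]
    meets the size bound. *)
Lemma winner_undominated_set x A e :
  {in A, forall v, undominated x v} -> max_degree G < b + e ->
  b ^ e * (max_degree G ^ 2 + 1) <= #|A| -> winner a b Staller x = Staller.
Proof.
move=> hA hD /exists_packing[P [sP cP pP]]; apply: winner_boxes pP _ cP => v vP.
split; first exact: hA (subsetP sP _ vP).
apply: leq_trans (subset_leq_card (subsetDl _ _)) _.
exact: leq_trans (card_closed_nbhd v) hD.
Qed.

Lemma winner_Dominator_first :
  (forall N A, #|N| <= a -> {in A, forall v, undominated (N, set0) v} ->
     #|G| <= #|A| + a * (max_degree G).+1 ->
     winner a b Staller (N, set0) = Staller) -> W G a b = Staller.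
Proof.
move=> h; apply: winner_Dominator_move => N _ cN; rewrite set0U /=.
apply: (h N [set v | [disjoint closed_nbhd v & N]]) => // [v|]; first by rewrite inE.
rewrite -(cardsC [set v | [disjoint closed_nbhd v & N]]) leq_add2l.
apply: leq_trans (leq_mul cN (leqnn _)); apply: leq_trans (card_closed_nbhd_hit N).
by apply: subset_leq_card; apply/subsetP=> v; rewrite !inE.
Qed.

End Strategy.
End ClosedNeighborhoods.

(** * Thresholds and the final case analysis *)

Lemma min_positive_ge (P : pred nat) k :
  (forall n, 0 < n -> n < k -> ~~ P n) -> enat_le (Some k) (min_positive P).
Proof.
move=> h; rewrite /min_positive; case: pselect => // ex /=.
case: ex_minnP => m /andP[m0 Pm] _; rewrite leqNgt.
by apply/negP=> /(h _ m0); rewrite Pm.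
Qed.

Lemma min_positive_le (P : pred nat) k :
  0 < k -> P k -> enat_le (min_positive P) (Some k).
Proof.
move=> k0 Pk; rewrite /min_positive; case: pselect => [ex|[]] /=.
  by case: ex_minnP => m _; apply; rewrite k0.
by exists k; rewrite k0.
Qed.

(** Both bounds come from Staller's wins at bias [k]; the second is the case a = k-1, positive since
    k >= 2. *)
Lemma thresholds_of_Staller (w : nat -> nat -> player) k : 2 <= k ->
  (forall a, 0 < a -> a < k -> w a k = Staller) ->
  enat_le (Some k) (min_positive (fun a => w a k == Dominator)) /\
  enat_le (min_positive (fun b => w k.-1 b == Staller)) (Some k).
Proof.
move=> k2 h; split; first by apply: min_positive_ge => n n0 nk; rewrite h.
by apply: min_positive_le; rewrite ?h //; lia.
Qed.

Theorem theorem5 (k : nat) (hk : 2 <= k) (G : sgraph) (Delta : nat)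
  (hDelta : max_degree G = Delta) :
  [/\ (* (a) *)
      ((k%:Q ^ (Delta%:Z - k%:Z + 1) * (Delta%:Q ^+ 2 + 1)
          <= (order_of G)%:Q)%R ->
        enat_le (Some k) (thr_a' G k) /\ enat_le (thr_b' G k.-1) (Some k)),
      (* (b) *)
      (k <= Delta ->
       ((k%:Q ^ (Delta%:Z - k%:Z + 1) + 1) * (Delta%:Q ^+ 2 + 1)
          <= (order_of G)%:Q)%R ->
        enat_le (Some k) (thr_a G k) /\ enat_le (thr_b G k.-1) (Some k))
    & (* (c) *)
      (Delta < k ->
       k.-1 * (Delta + 1) < order_of G ->
        enat_le (Some k) (thr_a G k) /\ enat_le (thr_b G k.-1) (Some k))].
Proof.
have k0 : 0 < k by lia.
have powE : k <= Delta.+1 ->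
    (k%:Q ^ (Delta%:Z - k%:Z + 1) = (k ^ (Delta.+1 - k))%:R)%R.
  move=> kD; have -> : (Delta%:Z - k%:Z + 1 = (Delta.+1 - k)%N%:Z)%R by lia.
  by rewrite -exprnP -pmulrn natrX.
have sqE : (Delta%:Q ^+ 2 + 1 = (Delta ^ 2 + 1)%:R :> rat)%R.
  by rewrite natrD natrX pmulrn.
have ordE : ((order_of G)%:Q = #|G|%:R :> rat)%R by rewrite -pmulrn.
split=> [|kD|Dk].
- rewrite sqE ordE => hn; apply: (@thresholds_of_Staller (W' G)) => // a a0 ak.
  have und : {in [set: G], forall v, undominated (set0, set0) v}.
    by move=> v _; rewrite /undominated disjoint_sym -setI_eq0 set0I.
  have [kD|Dk] := leqP k Delta.+1.
    apply: (@winner_undominated_set _ _ _ a0 k0 ak _ _ (Delta.+1 - k) und); first lia.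
    by move: hn; rewrite cardsT hDelta powE // -natrM ler_nat.
  (* Here the exponent is negative, but the bound is still positive, so there is a vertex; its whole
     closed neighborhood fits in one move of Staller. *)
  have /card_gt0P[v _] : 0 < #|G|.
    rewrite -(ltr0n rat); apply: lt_le_trans hn.
    by rewrite mulr_gt0 ?ltr0n ?addn1 // exprz_gt0 // ltr0z.
  apply: (@winner_one_box _ _ _ a0 k0 _ v); first exact: und.
  apply: leq_trans (subset_leq_card (subsetDl _ _)) _.
  by apply: leq_trans (card_closed_nbhd v) _; rewrite hDelta ltnW.
- rewrite sqE ordE powE; last exact: leqW.
  rewrite natr1 -natrM ler_nat => hn.
  apply: (@thresholds_of_Staller (W G)) => // a a0 ak.
  apply: winner_Dominator_first => // N A _ hA; rewrite hDelta => cA.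
  apply: (@winner_undominated_set _ _ _ a0 k0 ak _ _ (Delta.+1 - k) hA); first lia.
  (* As a < k <= Delta, the first move dominates at most (Delta-1)(Delta+1) < Delta^2+1 vertices,
     which the extra summand 1 in the bound absorbs. *)
  rewrite hDelta; nia.
- move=> hn; apply: (@thresholds_of_Staller (W G)) => // a a0 ak.
  apply: winner_Dominator_first => // N A _ hA; rewrite hDelta => cA.
  have /card_gt0P[v vA] : 0 < #|A| by rewrite /order_of in hn; nia.
  apply: (@winner_one_box _ _ _ a0 k0 _ v); first exact: hA.
  apply: leq_trans (subset_leq_card (subsetDl _ _)) _.
  by apply: leq_trans (card_closed_nbhd v) _; rewrite hDelta.
Qed.
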